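(* Let $\{\mathfrak{n}_0=U\oplus\mathfrak{g}_0,\langle\,,\rangle\}$ be the real 2-step nilpotent Lie algebra described in the context, with $\mathfrak{h}_0$ a maximal abelian subalgebra of $\mathfrak{g}_0$, $\mathfrak{h}=\mathfrak{h}_0^{\mathbb{C}}$, roots $\Phi$ and nonzero weights $\Lambda$ of $V=U^{\mathbb{C}}$. Let $\lambda\in\Lambda^+$ be an element such that there are no solutions to the equations $2\lambda=\alpha\in\Phi$ or $2\lambda=\alpha+\beta$, where $\alpha,\beta\in\Phi$. Let $u_\lambda$ be any element of $U_\lambda$. Then (with $\mathrm{ad}$ taken in $\mathfrak{n}_0$) $$\mathrm{ad}\,u_\lambda(U)\subseteq\mathbb{R}\tilde H_\lambda\oplus\mathfrak{g}_{0,\lambda}\oplus\sum_{\alpha\in\Phi_\lambda}\mathfrak{g}_{0,\alpha}.$$ Equality holds if $u_\lambda\in U_\lambda-\Sigma'_\lambda$.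
   Context: $\mathfrak{g}_0$ is a compact semisimple real Lie algebra (negative definite Killing form), $U$ a finite dimensional real $\mathfrak{g}_0$-module. $\langle\,,\rangle$ is a positive definite inner product on $\mathfrak{n}_0=U\oplus\mathfrak{g}_0$ such that $U\perp\mathfrak{g}_0$, every $X\in\mathfrak{g}_0$ acts skew symmetrically on $U$, and $\mathrm{ad}X:\mathfrak{g}_0\to\mathfrak{g}_0$ is skew symmetric for every $X\in\mathfrak{g}_0$. The bracket of $\mathfrak{n}_0$ is defined by: $\mathfrak{g}_0$ is central in $\mathfrak{n}_0$, $[\mathfrak{n}_0,\mathfrak{n}_0]\subseteq\mathfrak{g}_0$, and $\langle[u,u'],Z\rangle=\langle Z(u),u'\rangle$ for $u,u'\in U$, $Z\in\mathfrak{g}_0$. $\mathfrak{g}=\mathfrak{g}_0^{\mathbb{C}}$ has Cartan subalgebra $\mathfrak{h}$ and root spaces $\mathfrak{g}_\alpha$; $\mathfrak{g}_{0,\alpha}=(\mathfrak{g}_\alpha\oplus\mathfrak{g}_{-\alpha})\cap\mathfrak{g}_0$ for $\alpha\in\Phi$ and $\mathfrak{g}_{0,\mu}=\{0\}$ for $\mu\notin\Phi$. $V_\lambda=\{v\in V:Hv=\lambda(H)v\ \forall H\in\mathfrak{h}\}$; $V_0$ is the zero weight space; $U_\lambda=(V_\lambda\oplus V_{-\lambda})\cap U$; $\Lambda^+\subset\Lambda$ is a subset containing exactly one of each pair $\lambda,-\lambda$. $\tilde H_\lambda\in\mathfrak{h}_0$ is the unique vector with $\langle\tilde H,\tilde H_\lambda\rangle=-i\lambda(\tilde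 H)$ for all $\tilde H\in\mathfrak{h}_0$. $\Phi_\lambda=\{\alpha\in\Phi:V_{\lambda-\alpha}\neq\{0\}\}$. For $\alpha\in\Phi$ let $X_{-\alpha}$ be a nonzero element of $\mathfrak{g}_{-\alpha}$ and $\mathrm{Ker}(X_{-\alpha})$ the kernel of $X_{-\alpha}:V_\lambda\to V_{\lambda-\alpha}$. Put $\Sigma_\lambda=\mathrm{Ker}(X_{-\lambda})\cup\bigcup_{\alpha\in\Phi_\lambda}\mathrm{Ker}(X_{-\alpha})$ if $\lambda\in\Lambda\cap\Phi$, and $\Sigma_\lambda=\bigcup_{\alpha\in\Phi_\lambda}\mathrm{Ker}(X_{-\alpha})$ if $\lambda\notin\Lambda\cap\Phi$. Let $J:V\to V$ be the conjugation of $V=U^{\mathbb{C}}$ fixing $U$; the map $\varphi:V_\lambda\to U_\lambda$, $\varphi(v)=v+J(v)$, is an $\mathbb{R}$-linear isomorphism, and $\Sigma'_\lambda=\varphi(\Sigma_\lambda)$. *)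

(* Defs.v *)
From HB Require Import structures.
From mathcomp Require Import all_boot all_order all_algebra.
From mathcomp Require Import boolp classical_sets reals.
From mathcomp Require Import complex.

Set Implicit Arguments.
Unset Strict Implicit.
Unset Printing Implicit Defensive.

Import Order.TTheory GRing.Theory Num.Theory.
Import VectorInternalTheory.
Local Open Scope ring_scope.
Local Open Scope classical_set_scope.

Record complexified (W : Type) := Cplx { cre : W; cim : W }.

Definition pair_of_cplx W (v : complexified W) := (cre v, cim v).
Definition cplx_of_pair W (p : W * W) := Cplx p.1 p.2.
Lemma pair_of_cplxK W : cancel (@pair_of_cplx W) (@cplx_of_pair W).
Proof. by case. Qed.

HB.instance Definition _ (W : choiceType) :=
  Choice.copy (complexified W) (can_type (@pair_of_cplxK W)).

Section ComplexifiedZmod.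
Variable W : zmodType.
Implicit Types u v w : complexified W.

Definition cplx_add u v := Cplx (cre u + cre v) (cim u + cim v).
Definition cplx_opp v := Cplx (- cre v) (- cim v).

Let addA : associative cplx_add.
Proof. by move=> [a b] [c d] [e f]; rewrite /cplx_add /= !addrA. Qed.
Let addC : commutative cplx_add.
Proof. by move=> [a b] [c d]; congr Cplx; rewrite /= addrC. Qed.
Let add0 : left_id (Cplx 0 0) cplx_add.
Proof. by move=> [a b]; rewrite /cplx_add /= !add0r. Qed.
Let addN : left_inverse (Cplx 0 0) cplx_opp cplx_add.
Proof. by move=> [a b]; rewrite /cplx_add /= !addNr. Qed.

HB.instance Definition _ :=
  GRing.isZmodule.Build (complexified W) addA addC add0 addN.
End ComplexifiedZmod.

Section ComplexifiedLmod.
Variables (R : realType) (W : lmodType R).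

Definition cplx_scale (z : R[i]) (v : complexified W) :=
  Cplx (complex.Re z *: cre v - complex.Im z *: cim v)
       (complex.Re z *: cim v + complex.Im z *: cre v).

Let scaleA a b v : cplx_scale a (cplx_scale b v) = cplx_scale (a * b) v.
Proof.
case: a b v => [a a'] [b b'] [v v']; rewrite /cplx_scale /=.
congr Cplx; rewrite !(scalerBr, scalerDr, scalerBl, scalerDl) !scalerA ?opprD.
  by rewrite -!addrA; congr (_ + _); rewrite addrA addrC.
by rewrite -!addrA; congr (_ + _); rewrite addrA addrC.
Qed.
Let scale1 : left_id 1 cplx_scale.
Proof. by case=> v v'; rewrite /cplx_scale /= !scale0r !scale1r subr0 addr0. Qed.
Let scaleDr : right_distributive cplx_scale +%R.
Proof.
move=> [a b] [v v'] [w w']; rewrite /cplx_scale /=.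
by congr Cplx; rewrite /= !scalerDr ?opprD addrACA.
Qed.
Let scaleDl v : {morph cplx_scale^~ v : a b / a + b}.
Proof.
move=> [a a'] [b b']; case: v => v v'; rewrite /cplx_scale /=.
by congr Cplx; rewrite /= !scalerDl ?opprD addrACA.
Qed.

HB.instance Definition _ :=
  GRing.Zmodule_isLmodule.Build R[i] (complexified W)
    scaleA scale1 scaleDr scaleDl.
End ComplexifiedLmod.

Section ComplexifiedVect.
Variables (R : realType) (W : vectType R).

Definition cplx_v2r (v : complexified W) : 'rV[R[i]]_(dim W) :=
  \row_j Complex (v2r (cre v) 0 j) (v2r (cim v) 0 j).
Definition cplx_r2v (r : 'rV[R[i]]_(dim W)) : complexified W :=
  Cplx (r2v (map_mx (@complex.Re R) r)) (r2v (map_mx (@complex.Im R) r)).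

Lemma cplx_vector_axiom : Vector.axiom (dim W) (complexified W).
Proof.
exists cplx_v2r.
  move=> [a b] [v v'] [w w']; apply/rowP=> j.
  rewrite !mxE /= !linearD !linearN !linearZ !mxE /=.
  by rewrite mulrN.
exists cplx_r2v => [[v v']|r].
  congr Cplx; rewrite -[RHS]v2rK; congr r2v; apply/rowP=> j; by rewrite !mxE.
by apply/rowP=> j; rewrite !mxE /= !r2vK !mxE; case: (r 0 j).
Qed.

HB.instance Definition _ :=
  Lmodule_hasFinDim.Build R[i] (complexified W) cplx_vector_axiom.
End ComplexifiedVect.

Definition toC (W : zmodType) (w : W) : complexified W := Cplx w 0.

(* the conjugation J fixing the real form *)
Definition cplx_conj (W : zmodType) (v : complexified W) : complexified W :=
  Cplx (cre v) (- cim v).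

Definition cplx_map (A B : Type) (f : A -> B) (v : complexified A) :=
  Cplx (f (cre v)) (f (cim v)).

(* complex bilinear extension of a real bilinear map *)
Definition cplx_bil (A B D : zmodType) (f : A -> B -> D)
    (a : complexified A) (b : complexified B) : complexified D :=
  Cplx (f (cre a) (cre b) - f (cim a) (cim b))
       (f (cre a) (cim b) + f (cim a) (cre b)).

Definition sumset (W : zmodType) (A B : set W) : set W :=
  [set a + b | a in A & b in B].

(* sum of the F i over all i in P, as the set of all finite sums; correct as a
   sum of subspaces without knowing that P is finite *)
Definition sumfam (W : zmodType) (I : eqType) (P : set I) (F : I -> set W)
    : set W :=
  [set x | exists (s : seq I) (f : I -> W),
     (forall i, i \in s -> P i /\ F i (f i)) /\ x = \sum_(i <- s) f i].

Definition direct3 (W : zmodType) (A B D : set W) : Prop :=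
  forall a b d, A a -> B b -> D d -> a + b + d = 0 ->
    [/\ a = 0, b = 0 & d = 0].

Section LieAlgebras.
Variable R : realType.

Definition lie_bracket (L : vectType R) (br : {bilinear L -> L -> L}) : Prop :=
  (forall x, br x x = 0) /\
  (forall x y z, br x (br y z) + br y (br z x) + br z (br x y) = 0).

Definition lftrace (L : vectType R) (f : 'End(L)) : R :=
  \sum_(i < \dim {:L}) coord (vbasis {:L}) i (f (vbasis {:L})`_i).

Definition killing (L : vectType R) (br : {bilinear L -> L -> L}) (x y : L) : R :=
  lftrace (linfun (br x) \o linfun (br y))%VF.

Definition compact_semisimple (L : vectType R) (br : {bilinear L -> L -> L}) :=
  lie_bracket br /\ (forall x, x != 0 -> killing br x x < 0).

Definition lie_module (L U : vectType R) (br : {bilinear L -> L -> L})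
    (act : {bilinear L -> U -> U}) : Prop :=
  forall x y u, act (br x y) u = act x (act y u) - act y (act x u).

Definition abelian_sub (L : vectType R) (br : {bilinear L -> L -> L})
    (a : {vspace L}) : Prop :=
  forall x y, x \in a -> y \in a -> br x y = 0.

Definition maximal_abelian (L : vectType R) (br : {bilinear L -> L -> L})
    (a : {vspace L}) : Prop :=
  abelian_sub br a /\
  (forall b : {vspace L}, abelian_sub br b -> (a <= b)%VS -> b = a).

End LieAlgebras.

(* n0 = U (+) g0 is realized as the product U * g0 *)
Section TwoStep.
Variables (R : realType) (g0 U : vectType R).
Variables (br : {bilinear g0 -> g0 -> g0}) (act : {bilinear g0 -> U -> U}).

Definition inU (u : U) : (U * g0)%type := (u, 0).
Definition ing0 (Z : g0) : (U * g0)%type := (0, Z).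

Definition adapted_inner_product (ip : {dot (U * g0)%type for idfun}) : Prop :=
  [/\ forall u Z, ip (inU u) (ing0 Z) = 0,
      forall X u u', ip (inU (act X u)) (inU u') = - ip (inU u) (inU (act X u'))
    & forall X Y Z, ip (ing0 (br X Y)) (ing0 Z) = - ip (ing0 Y) (ing0 (br X Z))].

Definition two_step_bracket (ip : {dot (U * g0)%type for idfun})
    (brn : {bilinear (U * g0)%type -> (U * g0)%type -> (U * g0)%type}) : Prop :=
  [/\ lie_bracket brn,
      forall Z x, brn (ing0 Z) x = 0,
      forall x y, range ing0 (brn x y)
    & forall u u' Z, ip (brn (inU u) (inU u')) (ing0 Z)
                     = ip (inU (act Z u)) (inU u')].

End TwoStep.

Section Weights.
Variables (R : realType) (g0 : vectType R) (br : {bilinear g0 -> g0 -> g0}).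
Variable h0 : {vspace g0}.

Definition cartan : vectType R[i] := complexified (subvs_of h0).
(* linear forms on h = h0 (x) C *)
Definition functional : vectType R[i] := 'Hom(cartan, (R[i])^o).

Definition of_cartan (H : cartan) : complexified g0 := cplx_map vsval H.

Section WeightSpaces.
Variables (W : vectType R) (act : {bilinear g0 -> W -> W}).

(* For W = U this is V_lambda; for W = g0 with the adjoint action it is
   g_alpha. *)
Definition weight_space (lam : functional) : set (complexified W) :=
  [set v | forall H : cartan, cplx_bil act (of_cartan H) v = lam H *: v].

Definition lie_weights : set functional :=
  [set lam | lam != 0 /\ weight_space lam <> [set 0]].

(* (W_lambda (+) W_{-lambda}) intersected with the real form W *)
Definition real_weight_space (lam : functional) : set W :=
  [set w | sumset (weight_space lam) (weight_space (- lam)) (toC w)].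

End WeightSpaces.

(* nonzero weights of the adjoint representation *)
Definition lie_roots : set functional := lie_weights br.

Definition real_root_space (mu : functional) : set g0 :=
  if `[< lie_roots mu >] then real_weight_space br mu else [set 0].

(* Lp contains exactly one of each pair lam, - lam of elements of L *)
Definition half_of (L Lp : set functional) : Prop :=
  Lp `<=` L /\
  (forall lam, L lam -> (Lp lam \/ Lp (- lam)) /\ ~ (Lp lam /\ Lp (- lam))).

Variables (U : vectType R) (act : {bilinear g0 -> U -> U}).

Definition Phi_at (lam : functional) : set functional :=
  [set alpha | lie_roots alpha /\ weight_space act (lam - alpha) <> [set 0]].

(* the kernel of X : V_lambda -> V *)
Definition ker_at (lam : functional) (X : complexified g0) :
    set (complexified U) :=
  [set v | weight_space act lam v /\ cplx_bil act X v = 0].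

(* Xm alpha stands for X_{-alpha} *)
Definition negative_root_vectors (Xm : functional -> complexified g0) : Prop :=
  forall alpha, lie_roots alpha ->
    weight_space br (- alpha) (Xm alpha) /\ Xm alpha <> 0.

Definition Sigma (Xm : functional -> complexified g0) (lam : functional) :
    set (complexified U) :=
  let S := \bigcup_(alpha in Phi_at lam) ker_at lam (Xm alpha) in
  if `[< (lie_weights act `&` lie_roots) lam >]
  then ker_at lam (Xm lam) `|` S else S.

(* the image of Sigma under v |-> v + J v, as a subset of the real form U *)
Definition Sigma' (Xm : functional -> complexified g0) (lam : functional) :
    set U :=
  [set u | exists2 v, Sigma Xm lam v & toC u = v + cplx_conj v].

(* Ht is the vector H~_lam of h0 *)
Definition is_dual_vector (ip : {dot (U * g0)%type for idfun})
    (lam : functional) (Ht : subvs_of h0) : Prop :=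
  forall H : subvs_of h0,
    (ip (ing0 U (vsval H)) (ing0 U (vsval Ht)))%:C%C = - 'i%C * lam (toC H).

Definition real_line (W : vectType R) (x : W) : set W :=
  range (fun a : R => a *: x).

End Weights.

(* Main.v *)
Require Import Defs.
From HB Require Import structures.
From mathcomp Require Import all_boot all_order all_algebra.
From mathcomp Require Import boolp classical_sets reals.
From mathcomp Require Import complex.
From mathcomp Require Import spectral ring.

(** Write [V] for the complexification of [U], [J] for its conjugation, and [B]
for the complex bilinear extension to [V] of the bracket [U x U -> g0]. The
defining identity [<[u, w], Z> = <Z u, w>] together with the skewness of the
action makes the bracket equivariant, so [B] maps [V_lam x V_mu] into the weight
space of weight [lam + mu] of the adjoint representation ([bk_weight_space]).
Every [u] in [U_lam] is the real part of some [v] in [V_lam], and then [[u, w]]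
is the real part of [B(v, w)] for real [w].

Inclusion ([bk_in_sum]). The Cartan subalgebra acts by commuting skew operators,
so [V] is spanned by weight vectors ([weight_decomposition]) and [w] may be
replaced by a vector of [V_mu]. If [mu = - lam], then [B(v, w)] centralizes [h],
hence lies in [h] because [h0] is maximal abelian, and pairing it with [h] shows
that its real part is a multiple of the dual vector of [lam]
([bk_opposite_weight]). Otherwise, if [B(v, w)] is nonzero, [alpha = lam + mu]
is a root, and it belongs to [Phi_lam] because [J] exchanges [V_mu] and [V_(-mu)
= V_(lam - alpha)].

Equality. Let [E] be the chosen vector of [g_(-alpha)] with [alpha] in
[Phi_lam]. If [E v] is nonzero, then so is [B(v, J (E v))], since its product
with the conjugate of [E] is [|E v|^2]; as [g_alpha] is a complex line
([root_space_line]), every [X] in [g_alpha] is [B(v, w)] for a multiple [w] of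
[J (E v)]. The bracket of [u] with the real vector [w + J w] is the real part of
[B(v, w) + B(v, J w)], and the second term lies in the weight space of weight [2
lam - alpha], which is zero by the assumption on [2 lam]: this is
[bk_onto_root]. The dual vector is reached in the same way from [w = J(i v)],
the second term being [B(v, i v) = 0] ([bk_onto_dual]); this uses [v <> 0]. If
[v] were zero, [u] would lie in the image of [Sigma] as soon as [Phi_lam] is
nonempty, which [Phi_at_nonempty] provides.

The assumption on [2 lam], applied to [lam + lam], also excludes that [lam] is a
root. Therefore the middle summand [g_(0, lam)] vanishes, [Sigma] is the bare
union of kernels, and the sum is direct because the Cartan subalgebra is
orthogonal to all root spaces. *)

Set Implicit Arguments.
Unset Strict Implicit.
Unset Printing Implicit Defensive.

Import Order.TTheory GRing.Theory Num.Theory.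
Import passmx.

Local Open Scope ring_scope.
Local Open Scope classical_set_scope.

(** * Complexified bilinear maps, conjugation and Hermitian products *)

Section ComplexifiedMaps.
Variables (R : realType) (A B D : vectType R) (f : {bilinear A -> B -> D}).

Lemma cplx_bil_is_bilinear :
  bilinear_for *:%R *:%R (cplx_bil f : complexified A -> complexified B -> _).
Proof.
split=> [[c c']|[b b']] [z z'] [a a'] /=; [case=> b b'|case=> d d'];
  rewrite /cplx_bil /=; congr Cplx => /=;
  rewrite !(linearDl, linearBl, linearDr, linearBr, linearNl, linearNr,
            linearZl_LR, linearZr_LR) /=;
  rewrite ?(scalerDr, scalerBr, scalerN, opprD, opprK);
  rewrite addrACA [X in X + _]addrACA; congr (_ + _ + _); exact: addrC.
Qed.

HB.instance Definition _ :=
  bilinear_isBilinear.Build R[i] (complexified A) (complexified B)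
    (complexified D) *:%R *:%R (cplx_bil f) cplx_bil_is_bilinear.

Lemma cplx_bilDl x x' y :
  cplx_bil f (x + x') y = cplx_bil f x y + cplx_bil f x' y.
Proof. exact: (linearDl (cplx_bil f)). Qed.

Lemma cplx_bilNl x y : cplx_bil f (- x) y = - cplx_bil f x y.
Proof. exact: (linearNl (cplx_bil f)). Qed.

Lemma cplx_bilDr x y y' :
  cplx_bil f x (y + y') = cplx_bil f x y + cplx_bil f x y'.
Proof. exact: (linearDr (cplx_bil f)). Qed.

Lemma cplx_bilZl z x y : cplx_bil f (z *: x) y = z *: cplx_bil f x y.
Proof. exact: (linearZl_LR (cplx_bil f)). Qed.

Lemma cplx_bilZr z x y : cplx_bil f x (z *: y) = z *: cplx_bil f x y.
Proof. exact: (linearZr_LR (cplx_bil f)). Qed.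

Lemma cplx_bil_conj x y :
  cplx_conj (cplx_bil f x y) = cplx_bil f (cplx_conj x) (cplx_conj y).
Proof.
by case: x y => [a a'] [b b']; rewrite /cplx_conj /cplx_bil /=;
   rewrite !(linearNl, linearNr) opprK opprD.
Qed.

Lemma cplx_bil_real a b : cplx_bil f (toC a) (toC b) = toC (f a b).
Proof. by rewrite /cplx_bil /toC /= !linear0r linear0l subr0 addr0. Qed.
End ComplexifiedMaps.

Section RealStructure.
Variables (R : realType) (W : vectType R).
Implicit Types (v w : complexified W) (z : R[i]).

Fact cplx_conj_is_zmod_morphism : zmod_morphism (@cplx_conj W).
Proof. by move=> [a a'] [b b']; rewrite /cplx_conj /= !opprD. Qed.
HB.instance Definition _ := GRing.isZmodMorphism.Build
  (complexified W) (complexified W) (@cplx_conj W) cplx_conj_is_zmod_morphism.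

Fact cre_is_zmod_morphism : zmod_morphism (@cre W).
Proof. by []. Qed.
HB.instance Definition _ := GRing.isZmodMorphism.Build
  (complexified W) W (@cre W) cre_is_zmod_morphism.

Fact toC_is_zmod_morphism : zmod_morphism (@toC W).
Proof. by move=> a b; rewrite /toC; congr Cplx; rewrite /= subr0. Qed.
HB.instance Definition _ := GRing.isZmodMorphism.Build
  W (complexified W) (@toC W) toC_is_zmod_morphism.

Lemma cplx_conjK : involutive (@cplx_conj W).
Proof. by case=> a b; rewrite /cplx_conj /= opprK. Qed.

Lemma cplx_conjZ z v : cplx_conj (z *: v) = z^*%C *: cplx_conj v.
Proof.
by case: z v => [a a'] [v v']; rewrite /cplx_conj /=; congr Cplx;
   rewrite /= !(scaleNr, scalerN) ?opprK ?opprD.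
Qed.

Lemma cplx_conj_toC (x : W) : cplx_conj (toC x) = toC x.
Proof. by rewrite /cplx_conj /= oppr0. Qed.

Lemma toC_cre v : toC (cre v) *+ 2 = v + cplx_conj v.
Proof. by case: v => a b; congr Cplx; rewrite /= ?addr0 ?subrr. Qed.

End RealStructure.

Section HermitianExtension.
Variables (R : realType) (W : vectType R) (ip : {dot W for idfun}).
Implicit Types (v w : complexified W) (z : R[i]).

(** The extension of [ip] that is linear in its first argument; its real and
imaginary parts are written out so that identities reduce to ones over [R]. *)
Definition herm v w : R[i] :=
  Complex (ip (cre v) (cre w) + ip (cim v) (cim w))
          (ip (cim v) (cre w) - ip (cre v) (cim w)).

Lemma ipC a b : ip a b = ip b a.
Proof. by rewrite hermitian_subproof mul1r. Qed.

Lemma ipDl a b c : ip (a + b) c = ip a c + ip b c.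
Proof. exact: linearDl. Qed.

Lemma ipNl a c : ip (- a) c = - ip a c.
Proof. exact: linearNl. Qed.

Lemma ipBl a b c : ip (a - b) c = ip a c - ip b c.
Proof. exact: linearBl. Qed.

Lemma ipZl (k : R) a c : ip (k *: a) c = k * ip a c.
Proof. exact: linearZl_LR. Qed.

Lemma ip0l c : ip 0 c = 0.
Proof. exact: linear0l. Qed.

Lemma ip_eq0 a : ip a a = 0 -> a = 0.
Proof. by move=> a0; apply: contra_eq a0 => /neq0_dnorm_gt0/gt_eqF->. Qed.

Fact herm_is_hermitian v w : herm v w = (-1) ^+ false * (herm w v)^*%C.
Proof.
rewrite expr0 mul1r /herm /=; apply/eqP; rewrite eq_complex /=.
by rewrite opprB !(ipC (cre w)) !(ipC (cim w)) !eqxx.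
Qed.

Fact herm_linearl w : GRing.linear_for *%R (herm^~ w).
Proof.
move=> [a b] v v'; apply/eqP; rewrite eq_complex /herm /=.
rewrite !(linearDl, linearBl, linearNl, linearZl_LR) /=.
by apply/andP; split; apply/eqP; ring.
Qed.

Fact herm_is_bilinear : bilinear_for *%R (@conjc R \; *%R) herm.
Proof.
split=> [w|v]; first exact: herm_linearl.
move=> z w w' /=; rewrite herm_is_hermitian (herm_linearl v z).
by rewrite [herm v w]herm_is_hermitian [herm v w']herm_is_hermitian
  !mul1r !rmorphD !rmorphM.
Qed.

HB.instance Definition _ := bilinear_isBilinear.Build R[i] (complexified W)
  (complexified W) _ *%R (@conjc R \; *%R) herm herm_is_bilinear.
HB.instance Definition _ := isHermitianSesquilinear.Build R[i] (complexified W)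
  false (@conjc R) herm herm_is_hermitian.

Fact herm_gt0 v : v != 0 -> 0 < herm v v.
Proof.
have pos a : 0 <= ip a a.
  have [->|/neq0_dnorm_gt0/ltW//] := eqVneq a 0; by rewrite linear0l.
case: v => a b; rewrite /herm ltcE /= [ip b a]ipC subrr eqxx /= => v0.
have [a0|a0] := eqVneq a 0; last by rewrite ltr_pwDl ?pos ?neq0_dnorm_gt0.
have [b0|b0] := eqVneq b 0; last by rewrite ltr_wpDl ?pos ?neq0_dnorm_gt0.
by rewrite a0 b0 eqxx in v0.
Qed.
HB.instance Definition _ :=
  isDotProduct.Build R[i] (complexified W) herm herm_gt0.

Lemma hermDl v v' w : herm (v + v') w = herm v w + herm v' w.
Proof. exact: linearDl. Qed.

Lemma hermBl v v' w : herm (v - v') w = herm v w - herm v' w.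
Proof. exact: linearBl. Qed.

Lemma hermZl z v w : herm (z *: v) w = z * herm v w.
Proof. exact: linearZl_LR. Qed.

Lemma hermZr z v w : herm v (z *: w) = z^*%C * herm v w.
Proof. exact: linearZr_LR. Qed.

Lemma herm_eq0 v : herm v v = 0 -> v = 0.
Proof. by move=> v0; apply: contra_eq v0 => /herm_gt0/gt_eqF->. Qed.

Lemma herm_ge0 v : 0 <= herm v v.
Proof.
by have [->|/herm_gt0/ltW//] := eqVneq v 0; rewrite linear0l.
Qed.

Lemma hermNl v w : herm (- v) w = - herm v w.
Proof. exact: linearNl. Qed.

Lemma hermNr v w : herm v (- w) = - herm v w.
Proof. exact: linearNr. Qed.

End HermitianExtension.

Lemma cplx_inj (W : Type) (x y : complexified W) :
  cre x = cre y -> cim x = cim y -> x = y.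
Proof. by case: x y => [a b] [c d] /= -> ->. Qed.

Lemma cplx_real_imag (R : realType) (W : vectType R) (x : complexified W) :
  x = 'i%C *: toC (cim x) + toC (cre x).
Proof.
by apply: cplx_inj; rewrite /= ?(scale0r, scale1r, scaler0, oppr0, add0r, addr0).
Qed.

(** Multilinear identities pass from the real form to the complexification by
applying this to one argument at a time. *)
Lemma cplx_linear_ext (R : realType) (A B : vectType R)
    (f g : complexified A -> complexified B) :
  linear f -> linear g -> (forall a, f (toC a) = g (toC a)) -> f =1 g.
Proof.
move=> lf lg fg x; rewrite [x]cplx_real_imag.
apply: (etrans (lf _ _ _)); rewrite !fg; exact/esym/lg.
Qed.

(** * Modules over the complexified Lie algebra *)

Section Representations.
Variables (R : realType) (g0 : vectType R) (br : {bilinear g0 -> g0 -> g0}).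

Lemma cplx_lie_module (W : vectType R) (act : {bilinear g0 -> W -> W}) :
  lie_module br act -> forall x y v,
  cplx_bil act (cplx_bil br x y) v =
  cplx_bil act x (cplx_bil act y v) - cplx_bil act y (cplx_bil act x v).
Proof.
move=> mod x y v.
apply: (cplx_linear_ext (f := fun x => cplx_bil act (cplx_bil br x y) v)
  (g := fun x => cplx_bil act x (cplx_bil act y v)
                 - cplx_bil act y (cplx_bil act x v)) _ _ _ x) => [z a b|z a b|{}x].
- by rewrite !linearPl.
- by rewrite !(linearPl, linearPr) scalerBr opprD addrACA.
apply: (cplx_linear_ext (f := fun y => cplx_bil act (cplx_bil br (toC x) y) v)
  (g := fun y => cplx_bil act (toC x) (cplx_bil act y v)
                 - cplx_bil act y (cplx_bil act (toC x) v)) _ _ _ y)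
  => [z a b|z a b|{}y].
- by rewrite linearPr linearPl.
- by rewrite !(linearPl, linearPr) scalerBr opprD addrACA.
apply: (cplx_linear_ext
  (f := fun v => cplx_bil act (cplx_bil br (toC x) (toC y)) v)
  (g := fun v => cplx_bil act (toC x) (cplx_bil act (toC y) v)
                 - cplx_bil act (toC y) (cplx_bil act (toC x) v)) _ _ _ v)
  => [z a b|z a b|{}v].
- by rewrite linearPr.
- by rewrite !(linearPl, linearPr) scalerBr opprD addrACA.
by rewrite !cplx_bil_real mod raddfB.
Qed.

Lemma lie_antisym : lie_bracket br -> forall x y, br x y = - br y x.
Proof.
move=> [alt _] x y; apply/eqP; rewrite -addr_eq0.
by have:= alt (x + y); rewrite linearDl !linearDr !alt add0r addr0 => ->.
Qed.

Lemma cplx_lie_antisym : lie_bracket br ->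
  forall x y, cplx_bil br x y = - cplx_bil br y x.
Proof.
move=> lie x y; have anti := lie_antisym lie; congr Cplx.
  by rewrite /= 2!(anti (_ x)) !opprD.
by rewrite /= 2!(anti (_ x)) !opprD addrC.
Qed.

Lemma adjoint_module : lie_bracket br -> lie_module br br.
Proof.
move=> lie x y z; have anti := lie_antisym lie; have [_ jac] := lie.
have := jac x y z; rewrite (anti z x) linearNr (anti z (br x y)).
by move/eqP; rewrite subr_eq0 => /eqP <-.
Qed.

End Representations.

(** * Weight spaces of skew representations *)

Section Weights.
Variables (R : realType) (g0 : vectType R) (h0 : {vspace g0}).
Implicit Types (H K : cartan h0) (lam mu : functional h0).

Fact of_cartan_is_linear : linear (@of_cartan R g0 h0).
Proof.
move=> [a b] [x x'] [y y']; rewrite /of_cartan /cplx_map /=.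
exact: cplx_inj.
Qed.

Lemma of_cartan_conj H : of_cartan (cplx_conj H) = cplx_conj (of_cartan H).
Proof. exact: cplx_inj. Qed.

Section Module.
Variables (W : vectType R) (act : {bilinear g0 -> W -> W}).
Implicit Types (v w : complexified W).
Local Notation V := (weight_space act).

Lemma weight_space0 lam : V lam 0.
Proof. by move=> H; rewrite linear0r scaler0. Qed.

Lemma weight_spaceD lam v w : V lam v -> V lam w -> V lam (v + w).
Proof. by move=> lv lw H; rewrite cplx_bilDr lv lw scalerDr. Qed.

Lemma weight_spaceZ lam z v : V lam v -> V lam (z *: v).
Proof. by move=> lv H; rewrite cplx_bilZr lv !scalerA mulrC. Qed.

Lemma weight_space_neq0 lam v : V lam v -> v != 0 -> V lam <> [set 0].
Proof. by move=> lv v0 lE; move: lv; rewrite lE => /eqP; rewrite (negPf v0). Qed.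

Lemma weight_space_eq0 lam v : V lam = [set 0] -> V lam v -> v = 0.
Proof. by move=> ->. Qed.

Variable ip : {dot W for idfun}.
Hypothesis skew : forall X a b, ip (act X a) b = - ip a (act X b).

(** The adjoint of the action of a complex [X] is minus the action of its
conjugate: real elements act by skew operators. *)
Lemma herm_act X v w :
  herm ip (cplx_bil act X v) w = - herm ip v (cplx_bil act (cplx_conj X) w).
Proof.
apply/eqP; rewrite eq_complex /herm /=.
rewrite !(linearDl, linearBl, linearDr, linearBr, linearNl, linearNr) /= !skew.
by apply/andP; split; apply/eqP; ring.
Qed.

(** Weights are purely imaginary on the real form; in terms of the complex
Cartan subalgebra this becomes a symmetry under conjugation. *)
Lemma weight_imaginary lam v H :
  V lam v -> v != 0 -> (lam (cplx_conj H))^*%C = - lam H.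
Proof.
move=> lv v0; have := herm_act (of_cartan H) v v.
rewrite -of_cartan_conj !lv hermZl hermZr -mulNr => /mulIf ->.
  by rewrite opprK.
by rewrite gt_eqF ?herm_gt0.
Qed.

Lemma conj_weight_space lam v : V lam v -> V (- lam) (cplx_conj v).
Proof.
move=> lv; have [->|v0] := eqVneq v 0.
  by rewrite raddf0; apply: weight_space0.
move=> H; rewrite -[of_cartan H]cplx_conjK -of_cartan_conj -cplx_bil_conj lv.
by rewrite cplx_conjZ (weight_imaginary _ lv) // opp_lfunE.
Qed.

Lemma conj_weight_spaceN lam v : V (- lam) v -> V lam (cplx_conj v).
Proof. by move/conj_weight_space; rewrite opprK. Qed.

Lemma weight_spaces_orthogonal lam mu v w :
  lam != mu -> V lam v -> V mu w -> herm ip v w = 0.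
Proof.
move=> nlm lv mw; have [->|w0] := eqVneq w 0; first by rewrite linear0r.
apply: contra_neq_eq nlm => vw; apply/lfunP => H.
have := herm_act (of_cartan H) v w.
rewrite -of_cartan_conj lv mw hermZl hermZr (weight_imaginary _ mw) //.
by rewrite mulNr opprK => /mulIf ->.
Qed.

(** The component of [x] in [V_(-lam)] can be moved into [V_lam] by conjugation
without changing real parts. *)
Lemma real_weight_spaceP lam (x : W) :
  real_weight_space act lam x -> exists2 v, V lam v & x = cre v.
Proof.
case=> v lv [w lw vw]; exists (v + cplx_conj w).
  by apply: weight_spaceD => //; apply: conj_weight_spaceN.
by rewrite -[LHS]/(cre (toC x)) -vw.
Qed.

Lemma real_weight_space_cre lam v : V lam v -> real_weight_space act lam (cre v).
Proof.
move=> lv; exists (2^-1 *: v); first exact: weight_spaceZ.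
exists (2^-1 *: cplx_conj v); first exact/weight_spaceZ/conj_weight_space.
rewrite -scalerDr -toC_cre -scalerMnr scalerMnl -mulr_natr mulVf ?scale1r //.
by rewrite pnatr_eq0.
Qed.

End Module.
End Weights.

(** * Decomposition into weight vectors *)

(** The matrix version only concerns the whole space, so the operators are
restricted to [L] and written in a basis of it. *)
Lemma common_eigenvector_vspace (C : numClosedFieldType) (M : vectType C)
    (L : {vspace M}) (fs : seq 'End(M)) :
  L != 0%VS -> {in fs, forall f : 'End(M), {in L, forall v, f v \in L}} ->
  {in fs &, forall f g : 'End(M), {in L, forall v, f (g v) = g (f v)}} ->
  exists v, [/\ v \in L, v != 0 & {in fs, forall f : 'End(M), f v \in <[v]>%VS}].
Proof.
move=> L0 stab comm.
pose res (f : 'End(M)) : 'End(subvs_of L) := linfun (vsproj L \o f \o vsval).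
have resE (f : 'End(M)) v : f \in fs -> vsval (res f v) = f (vsval v).
  by move=> ffs; rewrite lfunE /= vsprojK // stab // subvsP.
have e_basis := vbasisP {:subvs_of L}; set e := vbasis _ in e_basis.
have n_gt0 : (0 < \dim {:subvs_of L})%N by rewrite dimvf lt0n dimv_eq0.
have [|r r0 /allP /= rP] := @common_eigenvector C _
    [seq mxof e e (res f) | f <- fs] n_gt0.
  move=> _ _ /mapP[f ffs ->] /mapP[g gfs ->].
  rewrite /comm_mx -!(mxof_comp e e e_basis); congr mxof.
  by apply/lfunP => v; rewrite !comp_lfunE; apply: val_inj;
     rewrite /= !resE // comm // subvsP.
exists (vsval (vecof e r)); split; first exact: subvsP.
  by rewrite -(linear0 (@vsval _ _ L)) (inj_eq (@subvs_inj _ _ L))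
    vecof_eq0.
move=> f ffs; have /sub_rVP[a ra] := rP _ (map_f _ ffs).
by rewrite -resE // (hom_vecof e e_basis) ra !linearZ memvZ ?memv_line.
Qed.

Section WeightDecomposition.
Variables (R : realType) (g0 : vectType R) (br : {bilinear g0 -> g0 -> g0}).
Variable h0 : {vspace g0}.
Hypothesis h0_abelian : abelian_sub br h0.
Variables (W : vectType R) (act : {bilinear g0 -> W -> W}).
Variable ip : {dot W for idfun}.
Hypothesis act_module : lie_module br act.
Hypothesis skew : forall X a b, ip (act X a) b = - ip a (act X b).
Implicit Types (H K : cartan h0) (lam mu : functional h0).
Implicit Types (v w : complexified W).
Local Notation V := (weight_space act).

Lemma cartan_commute H K v :
  cplx_bil act (of_cartan H) (cplx_bil act (of_cartan K) v) =
  cplx_bil act (of_cartan K) (cplx_bil act (of_cartan H) v).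
Proof.
apply/eqP; rewrite -subr_eq0 -(cplx_lie_module act_module).
have -> : cplx_bil br (of_cartan H) (of_cartan K) = 0.
  by apply: cplx_inj; rewrite /= !h0_abelian ?subvsP // ?addr0 ?subrr.
by rewrite linear0l.
Qed.

Lemma invariant_weight_vector (L : {vspace complexified W}) :
  L != 0%VS ->
  (forall H, {in L, forall v, cplx_bil act (of_cartan H) v \in L}) ->
  exists lam v, [/\ V lam v, v \in L & v != 0].
Proof.
move=> L0 stab; pose X := vbasis {:cartan h0}.
pose actC : {bilinear complexified g0 -> complexified W -> complexified W} :=
  cplx_bil act.
pose ad H : 'End(complexified W) := linfun (actC (of_cartan H)).
have adE H v : ad H v = cplx_bil act (of_cartan H) v
    by rewrite lfunE.
have [_ /mapP[H _ ->] v vL|_ _ /mapP[H _ ->] /mapP[K _ ->] v vL|] :=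
  @common_eigenvector_vspace _ _ L [seq ad H | H <- X] L0.
- by rewrite adE stab.
- by rewrite !adE cartan_commute.
move=> v [vL v0 vX].
have vH H : exists a, cplx_bil act (of_cartan H) v = a *: v.
  apply/vlineP; rewrite (coord_vbasis (memvf H)).
  have -> : of_cartan (\sum_i coord X i H *: X`_i) =
            \sum_i coord X i H *: of_cartan X`_i.
    elim/big_rec2: _ => [|i x y _ <-]; first exact: cplx_inj.
    exact: of_cartan_is_linear.
  rewrite (linear_sumlz actC) memv_suml // => i _.
  rewrite (linearZl_LR actC) memvZ // -[actC _ _]/(cplx_bil act _ _) -adE.
  by apply: vX; rewrite map_f // mem_nth // size_tuple.
(* The eigenvalue is a quotient of Hermitian products, visibly linear in H. *)
pose f H : R[i]^o := herm ip (cplx_bil act (of_cartan H) v) v / herm ip v v.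
have flin : linear f.
  move=> a H K; rewrite /f (of_cartan_is_linear a H K) cplx_bilDl cplx_bilZl.
  by rewrite hermDl hermZl mulrDl -mulrA.
pose F : {linear cartan h0 -> R[i]^o} :=
  HB.pack f (GRing.isLinear.Build _ _ _ _ f flin).
exists (linfun F), v; split=> // H; rewrite lfunE /= /f.
by have [a ->] := vH H; rewrite hermZl mulfK ?gt_eqF ?herm_gt0.
Qed.

(** As long as fewer than [dim] weight vectors are given, their orthogonal
complement is nonzero, and it is invariant because the action is skew; a weight
vector in it enlarges the free family. *)
Lemma free_weight_vectors n : (n <= dim (complexified W))%N ->
  exists X : n.-tuple (complexified W),
    free X /\ {in X, forall x, exists lam, V lam x}.
Proof.
elim: n => [_|n IHn ltn]; first by exists [tuple]; split=> //; exact: nil_free.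
have [X [freeX wX]] := IHn (ltnW ltn).
pose f w : 'rV[R[i]]_n := \row_i herm ip w X`_i.
have flin : linear f.
  by move=> a v w; apply/rowP => i; rewrite !mxE hermDl hermZl.
pose F : {linear complexified W -> 'rV[R[i]]_n} :=
  HB.pack f (GRing.isLinear.Build _ _ _ _ f flin).
pose L := lker (linfun F).
have LP w : w \in L -> forall x, x \in X -> herm ip w x = 0.
  rewrite memv_ker lfunE /= => /eqP/rowP fw _ /tnthP[i ->].
  by have := fw i; rewrite !mxE (tnth_nth 0).
have PL w : (forall x, x \in X -> herm ip w x = 0) -> w \in L.
  move=> wL; rewrite memv_ker lfunE /=; apply/eqP/rowP => i.
  by rewrite !mxE wL // mem_nth // size_tuple.
have L0 : L != 0%VS.
  rewrite -dimv_eq0 -lt0n -(ltn_add2r (\dim (limg (linfun F)))) add0n.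
  have := limg_ker_dim (linfun F) fullv; rewrite capfv dimvf => ->.
  apply: leq_ltn_trans ltn; apply: leq_trans (dimvS (subvf _)) _.
  by rewrite dimvf; have -> : dim 'rV[R[i]]_n = n by exact: mul1n.
have [|lam [v [lv vL v0]]] := invariant_weight_vector L0.
  move=> H v vL; apply: PL => x xX; have [mu mx] := wX x xX.
  rewrite (herm_act skew) -of_cartan_conj mx hermZr (LP v) // mulr0 oppr0 //.
exists [tuple of v :: X]; split; last first.
  by move=> x; rewrite inE => /predU1P[->|/wX//]; exists lam.
rewrite free_cons freeX andbT; apply: contra v0 => vX.
apply/eqP/(@herm_eq0 _ _ ip); rewrite [X in herm ip _ X](coord_span vX).
rewrite linear_sumr big1 // => i _; rewrite linearZr_LR /= (LP v) ?mulr0 //.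
by rewrite mem_nth // size_tuple.
Qed.

Lemma weight_decomposition v : sumfam [set: functional h0] V v.
Proof.
have [X [freeX wX]] := free_weight_vectors (leqnn _).
have basisX : basis_of {:complexified W} X.
  by rewrite basisEfree freeX subvf size_tuple dimvf /=.
have /fin_all_exists[lam lamP] (i : 'I_(dim (complexified W))) :
  exists mu, V mu X`_i by apply: wX; rewrite mem_nth // size_tuple.
pose c i := coord X i v *: X`_i.
exists (undup [seq lam i | i <- index_enum 'I_(dim (complexified W))]).
exists (fun mu => \sum_(i | lam i == mu) c i); split.
  move=> mu _; split=> //; elim/big_ind: _ => [|x y|i /eqP <-].
  - exact: weight_space0.
  - exact: weight_spaceD.
  - exact: weight_spaceZ.
rewrite [LHS](coord_basis basisX (memvf v)).
rewrite (exchange_big_dep xpredT) //=; apply: eq_bigr => i _.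
under eq_bigl do rewrite eq_sym.
rewrite -big_filter filter_pred1_uniq ?undup_uniq ?big_seq1 //.
by rewrite mem_undup map_f // mem_index_enum.
Qed.

End WeightDecomposition.

(** * Roots of a Lie algebra with an invariant inner product *)

Section Roots.
Variables (R : realType) (g0 : vectType R) (br : {bilinear g0 -> g0 -> g0}).
Variables (h0 : {vspace g0}) (ip : {dot g0 for idfun}).
Hypothesis lie : lie_bracket br.
Hypothesis h0_max : maximal_abelian br h0.
Hypothesis skew : forall X Y Z, ip (br X Y) Z = - ip Y (br X Z).
Implicit Types (H K : cartan h0) (lam alpha : functional h0).
Local Notation g_ := (weight_space br).

Lemma bracket_weight_space (W : vectType R) (act : {bilinear g0 -> W -> W})
    lam alpha X v :
  lie_module br act -> g_ alpha X -> weight_space act lam v ->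
  weight_space act (lam + alpha) (cplx_bil act X v).
Proof.
move=> mod gX lv H; have := cplx_lie_module mod (of_cartan H) X v.
rewrite gX lv !cplx_bilZl cplx_bilZr => /esym/eqP; rewrite subr_eq => /eqP ->.
by rewrite -scalerDl add_lfunE addrC.
Qed.

(** Adjoining a centralizing [x] to [h0] gives an abelian subalgebra again. *)
Lemma centralizer_maximal_abelian x : {in h0, forall y, br y x = 0} -> x \in h0.
Proof.
move=> cx; have [ab maxab] := h0_max.
have [alt _] := lie; have anti := lie_antisym lie.
rewrite -(maxab (h0 + <[x]>)%VS) ?addvSl //.
  exact: subvP (addvSr _ _) _ (memv_line x).
move=> s t /memv_addP[y yh [_ /vlineP[a ->] ->]].
move=> /memv_addP[z zh [_ /vlineP[b ->] ->]].
rewrite linearDl !linearDr !linearZl_LR !linearZr_LR /= ab // alt cx //.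
by rewrite anti cx // oppr0 !scaler0 !addr0.
Qed.

Lemma zero_weight_spaceP X : g_ (0 : functional h0) X <-> exists K, X = of_cartan K.
Proof.
have [ab _] := h0_max; split=> [gX|[K ->] H]; last first.
  rewrite zero_lfunE scale0r.
  by apply: cplx_inj; rewrite /= !ab ?subvsP // ?addr0 ?subrr.
have gXy y (hy : y \in h0) : br y (cre X) = 0 /\ br y (cim X) = 0.
  have := gX (toC (Subvs hy)); rewrite zero_lfunE scale0r /cplx_bil /=.
  by rewrite !linear0l subr0 addr0 => -[].
have hre : cre X \in h0 by apply: centralizer_maximal_abelian => y /gXy[].
have him : cim X \in h0 by apply: centralizer_maximal_abelian => y /gXy[].
by exists (Cplx (Subvs hre) (Subvs him)); apply: cplx_inj.
Qed.

(** For [X] and [Y] in the same root space the bracket of [X] with the conjugate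
of [Y] lies in the Cartan subalgebra; this formula determines it there. *)
Lemma herm_bracket_conj alpha X Y K : g_ alpha Y ->
  herm ip (cplx_bil br X (cplx_conj Y)) (of_cartan K) =
  - (alpha K)^*%C * herm ip X Y.
Proof.
move=> gY; rewrite (cplx_lie_antisym lie) hermNl (herm_act skew) cplx_conjK.
by rewrite (cplx_lie_antisym lie) gY opprK hermNr hermZr mulNr.
Qed.

(** Let [Z] in [g_alpha] be orthogonal to [X], and let [X'] be the conjugate of
[X]. By [herm_bracket_conj], [[Z, X'] = 0], and [H = [X, X']] satisfies
[|H|^2 = - c |X|^2] where [c] is the conjugate of [alpha H]. Moving [X] to the
other side gives [|[X, Z]|^2 = c |Z|^2]. If [Z] were nonzero, [c] would be both
nonpositive and nonnegative, so [H = 0], and [herm_bracket_conj] would give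
[alpha = 0]. *)
Lemma root_space_line alpha X Y :
  alpha != 0 -> g_ alpha X -> g_ alpha Y -> X != 0 -> exists c, Y = c *: X.
Proof.
move=> alpha0 gX gY X0; have mod := adjoint_module lie.
have anti := cplx_lie_antisym lie.
have cX : g_ (- alpha) (cplx_conj X) by apply: conj_weight_space gX.
have cartanX Z : g_ alpha Z ->
    exists K, cplx_bil br Z (cplx_conj X) = of_cartan K.
  move=> gZ; apply/zero_weight_spaceP; rewrite -(addNr alpha).
  exact: bracket_weight_space.
pose c := herm ip Y X / herm ip X X; exists c; apply/eqP; rewrite -subr_eq0.
set Z := Y - c *: X; apply/negPn/negP => Z0.
have gZ : g_ alpha Z.
  by rewrite /Z -scaleNr; apply: weight_spaceD => //; apply: weight_spaceZ.
have XX0 : herm ip X X != 0 by rewrite gt_eqF ?herm_gt0.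
have ZX : herm ip Z X = 0 by rewrite hermBl hermZl mulfVK ?subrr.
have [K ZXK] := cartanX Z gZ; have [H XXH] := cartanX X gX.
have ZXc : cplx_bil br Z (cplx_conj X) = 0.
  apply: (@herm_eq0 _ _ ip); rewrite {2}ZXK (herm_bracket_conj _ _ gX).
  by rewrite ZX mulr0.
have HH : herm ip (of_cartan H) (of_cartan H) = - (alpha H)^*%C * herm ip X X.
  by rewrite -{1}XXH (herm_bracket_conj _ _ gX).
have XZ : herm ip (cplx_bil br X Z) (cplx_bil br X Z)
          = (alpha H)^*%C * herm ip Z Z.
  rewrite (herm_act skew); have := cplx_lie_module mod (cplx_conj X) X Z.
  rewrite (anti (cplx_conj X) Z) ZXc oppr0 linear0r subr0 => <-.
  rewrite (anti (cplx_conj X)) XXH cplx_bilNl gZ.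
  by rewrite hermNr opprK hermZr.
have aH : (alpha H)^*%C = 0.
  apply/eqP; rewrite eq_le; apply/andP; split.
    by rewrite -oppr_ge0 -(pmulr_lge0 _ (herm_gt0 ip X0)) -HH herm_ge0.
  by rewrite -(pmulr_lge0 _ (herm_gt0 ip Z0)) -XZ herm_ge0.
have H0 : of_cartan H = 0 by apply: (@herm_eq0 _ _ ip); rewrite HH aH oppr0 mul0r.
apply: (negP alpha0); apply/eqP/lfunP => K'; rewrite zero_lfunE.
have := herm_bracket_conj X K' gX; rewrite XXH H0 linear0l.
by move/esym/eqP; rewrite mulf_eq0 (negPf XX0) orbF oppr_eq0 conjc_eq0 => /eqP.
Qed.

End Roots.

(** * The bracket of the 2-step nilpotent Lie algebra *)

Section MetricTwoStep.
Variables (R : realType) (g0 U : vectType R).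
Variables (br : {bilinear g0 -> g0 -> g0}) (act : {bilinear g0 -> U -> U}).
Variables (ipg : {dot g0 for idfun}) (ipU : {dot U for idfun}).
(* bk is the bracket of n0 on U, with values in the centre g0. *)
Variables (bk : {bilinear U -> U -> g0}) (h0 : {vspace g0}).
Hypothesis lie : lie_bracket br.
Hypothesis act_module : lie_module br act.
Hypothesis h0_max : maximal_abelian br h0.
Hypothesis skewg : forall X Y Z, ipg (br X Y) Z = - ipg Y (br X Z).
Hypothesis skewU : forall X u w, ipU (act X u) w = - ipU u (act X w).
Hypothesis bk_alt : forall u, bk u u = 0.
Hypothesis bkE : forall u w Z, ipg (bk u w) Z = ipU (act Z u) w.
Implicit Types (H K : cartan h0) (lam mu alpha : functional h0).
Implicit Types (v w : complexified U).
Local Notation g_ := (weight_space br).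
Local Notation V := (weight_space act).

Lemma bk_equivariant X a b : br X (bk a b) = bk (act X a) b + bk a (act X b).
Proof.
have pair Z : ipg (br X (bk a b)) Z = ipg (bk (act X a) b + bk a (act X b)) Z.
  rewrite skewg ipDl !bkE act_module ipBl (skewU X).
  by rewrite opprD !opprK addrC.
by apply/eqP; rewrite -subr_eq0; apply/eqP/(@ip_eq0 _ _ ipg);
   rewrite ipBl pair subrr.
Qed.

Lemma cplx_bk_equivariant X v w :
  cplx_bil br X (cplx_bil bk v w) =
  cplx_bil bk (cplx_bil act X v) w + cplx_bil bk v (cplx_bil act X w).
Proof.
apply: (cplx_linear_ext (f := fun X => cplx_bil br X (cplx_bil bk v w))
  (g := fun X => cplx_bil bk (cplx_bil act X v) w
                 + cplx_bil bk v (cplx_bil act X w)) _ _ _ X)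
  => [z a b|z a b|{}X].
- by rewrite linearPl.
- by rewrite !(linearPl, linearPr) scalerDr addrACA.
apply: (cplx_linear_ext (f := fun v => cplx_bil br (toC X) (cplx_bil bk v w))
  (g := fun v => cplx_bil bk (cplx_bil act (toC X) v) w
                 + cplx_bil bk v (cplx_bil act (toC X) w)) _ _ _ v)
  => [z a b|z a b|{}v].
- by rewrite linearPl linearPr.
- by rewrite !(linearPl, linearPr) scalerDr addrACA.
apply: (cplx_linear_ext
  (f := fun w => cplx_bil br (toC X) (cplx_bil bk (toC v) w))
  (g := fun w => cplx_bil bk (cplx_bil act (toC X) (toC v)) w
                 + cplx_bil bk (toC v) (cplx_bil act (toC X) w)) _ _ _ w)
  => [z a b|z a b|{}w].
- by rewrite !linearPr.
- by rewrite !(linearPl, linearPr) scalerDr addrACA.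
by rewrite !cplx_bil_real bk_equivariant raddfD.
Qed.

Lemma bk_weight_space lam mu v w :
  V lam v -> V mu w -> g_ (lam + mu) (cplx_bil bk v w).
Proof.
move=> lv mw H; rewrite cplx_bk_equivariant lv mw cplx_bilZl cplx_bilZr.
by rewrite -scalerDl add_lfunE.
Qed.

Lemma herm_bk v w Z :
  herm ipg (cplx_bil bk v w) Z
  = herm ipU (cplx_bil act (cplx_conj Z) v) (cplx_conj w).
Proof.
apply/eqP; rewrite eq_complex /herm /=.
rewrite !(linearDl, linearBl, linearNl, linearNr) /= !bkE.
by apply/andP; split; apply/eqP; ring.
Qed.

Lemma cplx_bk_alt v : cplx_bil bk v v = 0.
Proof.
apply: cplx_inj; rewrite /= ?bk_alt ?subrr //.
have := bk_alt (cre v + cim v).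
by rewrite linearDl !linearDr !bk_alt add0r addr0.
Qed.

(** A vector of [U_lam] is handled as [cre v] with [v] in [V_lam]; this lemma
and the next one express its brackets through the complex bilinear map. *)
Lemma bk_cre v (x : U) : bk (cre v) x = cre (cplx_bil bk v (toC x)).
Proof. by rewrite /= linear0r subr0. Qed.

Lemma bk_cre_cre v w :
  bk (cre v) (cre w *+ 2)
  = cre (cplx_bil bk v w) + cre (cplx_bil bk v (cplx_conj w)).
Proof. by rewrite bk_cre raddfMn toC_cre cplx_bilDr raddfD. Qed.

Section AtWeight.
Variables (lam : functional h0) (Ht : subvs_of h0) (v : complexified U).
Hypothesis lam_v : V lam v.
Hypothesis Ht_dual : forall H : subvs_of h0,
  (ipg (vsval H) (vsval Ht))%:C%C = - 'i%C * lam (toC H).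

(** Both sides lie in [h0], so it is enough to compare their products with the
elements of [h0]. *)
Lemma bk_opposite_weight w : V (- lam) w ->
  cre (cplx_bil bk v w)
  = complex.Re ('i%C * herm ipU v (cplx_conj w)) *: vsval Ht.
Proof.
move=> lw; set c := complex.Re _.
have [K BK] : exists K : cartan h0, cplx_bil bk v w = of_cartan K.
  apply/(zero_weight_spaceP lie h0_max); rewrite -(subrr lam).
  exact: bk_weight_space.
have pair (H : subvs_of h0) :
    ipg (cre (cplx_bil bk v w)) (vsval H) = c * ipg (vsval Ht) (vsval H).
  have -> : ipg (cre (cplx_bil bk v w)) (vsval H)
            = complex.Re (herm ipg (cplx_bil bk v w) (toC (vsval H))).
    by rewrite /herm /= linear0r addr0.
  rewrite herm_bk cplx_conj_toC.
  have -> : toC (vsval H) = of_cartan (toC H) by exact: cplx_inj.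
  rewrite lam_v hermZl.
  have -> : lam (toC H) = 'i%C * (ipg (vsval Ht) (vsval H))%:C%C.
    by rewrite (ipC ipg) Ht_dual mulrA mulrN -expr2 sqr_i opprK mul1r.
  rewrite /c; case: (herm ipU v _) => a b /=.
  by rewrite !(mul0r, mul1r, sub0r, addr0, subr0); ring.
apply/eqP; rewrite -subr_eq0; apply/eqP/(@ip_eq0 _ _ ipg).
have {2}-> : cre (cplx_bil bk v w) - c *: vsval Ht = vsval (cre K - c *: Ht).
  by rewrite BK.
by rewrite ipBl ipZl pair subrr.
Qed.

(** When [x] is split into weight vectors of weights [mu], the term [mu = - lam]
contributes to the line, the terms for which [lam + mu] is a root contribute to
the sum over [Phi_lam], and all others vanish. *)
Lemma bk_in_sum x :
  sumset (real_line (vsval Ht))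
    (sumfam (Phi_at br act lam) (real_root_space br (h0 := h0)))
    (bk (cre v) x).
Proof.
have [ab _] := h0_max.
have [s [f [fV xE]]] := weight_decomposition ab act_module skewU (toC x).
pose B mu := cplx_bil bk v (f mu).
have -> : bk (cre v) x = \sum_(mu <- s) cre (B mu).
  by rewrite bk_cre xE (linear_sumr (cplx_bil bk)) raddf_sum.
pose P mu := (lam + mu != 0) && (B mu != 0).
(* For mu in P, the nonzero vector B mu shows that lam + mu is a root. *)
rewrite (bigID (fun mu => ~~ P mu)) /=.
exists (\sum_(mu <- s | ~~ P mu) cre (B mu)).
  rewrite big_seq_cond; elim/big_ind: _ => [|_ _ [a _ <-] [b _ <-]|mu].
  - by exists 0; rewrite ?scale0r.
  - by exists (a + b); rewrite ?scalerDl.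
  case/andP=> mus; rewrite negb_and !negbK => /orP[lm0|/eqP ->]; last first.
    by exists 0; rewrite ?scale0r.
  have muE : mu = - lam by apply/eqP; rewrite -addr_eq0 addrC.
  have [_] := fV _ mus; rewrite {1}muE => lw.
  by rewrite (bk_opposite_weight lw); eexists.
eexists; last by [].
exists [seq lam + mu | mu <- s & P mu], (fun alpha => cre (B (alpha - lam))).
split; last first.
  rewrite big_map big_filter; apply: eq_big => [mu|mu _]; first by rewrite negbK.
  by rewrite [lam + mu]addrC addrK.
move=> alpha /mapP[mu]; rewrite mem_filter => /andP[/andP[lm0 B0] mus] ->.
have [_ fmu] := fV _ mus.
rewrite [lam + mu]addrC addrK.
have gB : g_ (mu + lam) (B mu) by rewrite addrC; apply: bk_weight_space.
have root : lie_roots br (mu + lam).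
  by split; [rewrite addrC | apply: weight_space_neq0 gB B0].
split; first split=> //.
  rewrite opprD addrCA subrr addr0.
  apply: (weight_space_neq0 (conj_weight_space skewU fmu)).
  apply: contra B0 => /eqP c0; rewrite /B -[f mu]cplx_conjK c0 raddf0.
  by rewrite (linear0r (cplx_bil bk)).
rewrite /real_root_space asboolT //.
exact: (real_weight_space_cre skewg gB).
Qed.

(** The vector [J (E v)] has weight [alpha - lam], so pairing with it lands on
the line [g_alpha]; the vanishing of [g_(2 lam - alpha)] removes the unwanted
contribution of its conjugate. *)
Lemma bk_onto_root alpha E x : alpha != 0 ->
  g_ (- alpha) E -> cplx_bil act E v != 0 -> g_ (lam *+ 2 - alpha) = [set 0] ->
  real_weight_space br alpha x -> exists y, bk (cre v) y = x.
Proof.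
move=> alpha0 gE Ev0 g0E gx; have [X gX ->] := real_weight_spaceP skewg gx.
pose w := cplx_conj (cplx_bil act E v).
have EvV : V (lam - alpha) (cplx_bil act E v) by apply: bracket_weight_space.
have wV : V (alpha - lam) w by rewrite -opprB; apply: conj_weight_space EvV.
have gB : g_ alpha (cplx_bil bk v w).
  by have := bk_weight_space lam_v wV; rewrite addrCA subrr addr0.
have B0 : cplx_bil bk v w != 0.
  apply/eqP => B0; have := herm_bk v w (cplx_conj E).
  rewrite B0 !cplx_conjK (linear0l (herm ipg)) => /esym/herm_eq0/eqP.
  by rewrite (negPf Ev0).
have [c ->] := root_space_line lie h0_max skewg alpha0 gB gX B0.
exists (cre (c *: w) *+ 2); rewrite bk_cre_cre cplx_bilZr.
have -> : cplx_bil bk v (cplx_conj (c *: w)) = 0; last by rewrite addr0.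
apply: (weight_space_eq0 g0E); rewrite mulr2n -addrA; apply: bk_weight_space => //.
by rewrite cplx_conjZ cplx_conjK; apply: weight_spaceZ.
Qed.

(** Pairing with [w = J (i v)] gives [|v|^2] times the dual vector, while the
conjugate [i v] of [w] contributes [B(v, i v) = 0]. *)
Lemma bk_onto_dual : v != 0 -> exists y, bk (cre v) y = vsval Ht.
Proof.
move=> v0; pose w := cplx_conj ('i%C *: v).
have wV : V (- lam) w by apply/(conj_weight_space skewU)/weight_spaceZ.
pose c := complex.Re (herm ipU v v).
have c0 : c != 0.
  have := herm_gt0 ipU v0; rewrite ltcE => /andP[_]; by move/gt_eqF => /= ->.
exists (c^-1 *: (cre w *+ 2)); rewrite linearZr_LR bk_cre_cre.
rewrite (bk_opposite_weight wV) !cplx_conjK cplx_bilZr cplx_bk_alt scaler0 addr0.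
have -> : complex.Re ('i%C * herm ipU v ('i%C *: v)) = c.
  rewrite hermZr mulrA /c; case: (herm ipU v v) => a b /=.
  by rewrite !(mul0r, mul1r, mulr0, subr0, mulrN, oppr0, mulr1, opprK, sub0r,
       addr0, mulN1r, add0r).
by rewrite scalerA mulVf ?scale1r.
Qed.

(** If [Phi_lam] were empty, the brackets with [u = cre v] would fill exactly
the line spanned by the dual vector [T], so the stabilizer of [u] would be the
hyperplane orthogonal to [T]. Modulo this hyperplane all elements are multiples
of [T], whence all brackets [[X, Y]] stabilize [u] and are orthogonal to [T].
By invariance of the inner product [T] is central, so [T = 0] and [lam = 0]. *)
Lemma Phi_at_nonempty :
  (forall Z, (forall X, br X Z = 0) -> Z = 0) -> lam != 0 -> v != 0 ->
  exists alpha, Phi_at br act lam alpha.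
Proof.
move=> center lam0 v0; apply: contrapT => noPhi; apply: (negP lam0).
pose T := vsval Ht; pose u := cre v.
have line x : exists a, bk u x = a *: T.
  have [_ [a _ <-] [_ [s [f [fP ->]]] <-]] := bk_in_sum x.
  exists a; rewrite big_seq big1 ?addr0 // => alpha /fP[Phia _].
  by case: noPhi; exists alpha.
have stab Z : ipg T Z = 0 -> act Z u = 0.
  move=> TZ; apply: (@ip_eq0 _ _ ipU); rewrite -bkE.
  by have [a ->] := line (act Z u); rewrite ipZl TZ mulr0.
have [y uy] : exists y, bk u y = T by exact: bk_onto_dual.
have [alt _] := lie; have anti := lie_antisym lie.
have T0 : T = 0.
  apply: contrapT => /eqP T0; have TT : ipg T T != 0.
    by rewrite gt_eqF ?neq0_dnorm_gt0.
  pose c X := ipg T X / ipg T T.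
  have actu X : act X u = c X *: act T u.
    apply/eqP; rewrite -subr_eq0 -linearZl_LR -linearBl; apply/eqP/stab.
    by rewrite (ipC ipg) ipBl ipZl (ipC ipg X) mulfVK ?subrr.
  have actTu X : act X (act T u) = c X *: act T (act T u).
    have : act (br X T) u = 0.
      by apply: stab; rewrite (ipC ipg) anti ipNl skewg alt (ipC ipg) ip0l !oppr0.
    by rewrite act_module (actu X) linearZr_LR => /eqP; rewrite subr_eq0 => /eqP.
  have TXY X Y : ipg T (br X Y) = 0.
    rewrite -{1}uy bkE act_module (actu X) (actu Y) !linearZr_LR /=.
    by rewrite (actTu X) (actTu Y) !scalerA mulrC subrr linear0l.
  move/eqP: T0; apply; apply: center => X; apply: (@ip_eq0 _ _ ipg).
  by rewrite skewg TXY oppr0.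
apply/eqP/lfunP => H; rewrite zero_lfunE.
have lam_toC x : lam (toC x) = 0.
  have := Ht_dual x; rewrite -/T T0 (ipC ipg) ip0l => /esym/eqP.
  by rewrite mulf_eq0 oppr_eq0 => /orP[/eqP[] /eqP|/eqP//]; rewrite oner_eq0.
rewrite [H]cplx_real_imag.
have -> : lam ('i%C *: toC (cim H) + toC (cre H))
          = 'i%C *: lam (toC (cim H)) + lam (toC (cre H)) by exact: linearP.
by rewrite !lam_toC scaler0 addr0.
Qed.

End AtWeight.
End MetricTwoStep.

(** * The components of the orthogonal sum of U and g0 *)

Section PullbackDot.
Variables (R : realType) (W X : vectType R) (ip : {dot X for idfun}).
Variable j : W -> X.
Hypotheses (j_lin : linear j) (j_inj : injective j).

Definition pullback (a b : W) : R := ip (j a) (j b).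

Fact pullback_bilinear : bilinear_for *%R (idfun \; *%R) pullback.
Proof.
have lin b : GRing.linear_for *%R (pullback^~ b).
  by move=> k a c; rewrite /pullback j_lin ipDl ipZl.
split=> // a k b c; rewrite /pullback !(ipC ip (j a)); exact: lin.
Qed.

Fact pullback_hermitian a b : pullback a b = (-1) ^+ false * idfun (pullback b a).
Proof. by rewrite mul1r /pullback ipC. Qed.

Fact pullback_gt0 a : a != 0 -> 0 < pullback a a.
Proof.
move=> a0; apply: neq0_dnorm_gt0; apply: contra a0 => /eqP ja0.
have j0 : j 0 = 0 by have := j_lin (-1) 0 0; rewrite scaler0 addr0 scaleN1r addNr.
by apply/eqP/j_inj; rewrite ja0 j0.
Qed.

Definition pullback_dot : {dot W for idfun} :=
  HB.pack pullback
    (bilinear_isBilinear.Build R W W R *%R (idfun \; *%R) pullback pullback_bilinear)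
    (isHermitianSesquilinear.Build R W false idfun pullback pullback_hermitian)
    (isDotProduct.Build R W pullback pullback_gt0).
End PullbackDot.

Section BracketProjection.
Variables (R : realType) (g0 U : vectType R).
Variable brn : {bilinear (U * g0)%type -> (U * g0)%type -> (U * g0)%type}.

Definition derived_bracket (u w : U) : g0 := (brn (inU g0 u) (inU g0 w)).2.

Lemma inU_linear : linear (@inU R g0 U).
Proof. by move=> k a b; rewrite /inU; congr pair; rewrite /= scaler0 addr0. Qed.

Lemma ing0_linear : linear (@ing0 R g0 U).
Proof. by move=> k a b; rewrite /ing0; congr pair; rewrite /= scaler0 addr0. Qed.

Fact derived_bracket_bilinear : bilinear_for *:%R *:%R derived_bracket.
Proof.
split=> [w|u] k a b; rewrite /derived_bracket inU_linear.
  by rewrite linearDl linearZl_LR.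
by rewrite linearDr linearZr_LR.
Qed.

HB.instance Definition _ := bilinear_isBilinear.Build R U U g0 *:%R *:%R
  derived_bracket derived_bracket_bilinear.
End BracketProjection.

(** A central element has zero adjoint operator, hence zero Killing norm. *)
Lemma compact_center (R : realType) (g0 : vectType R)
    (br : {bilinear g0 -> g0 -> g0}) : compact_semisimple br ->
  forall Z, (forall X, br X Z = 0) -> Z = 0.
Proof.
move=> [lie neg] Z cZ; apply: contra_eq (erefl (0 : R)) => /neg.
have -> : killing br Z Z = 0; last by rewrite ltxx.
rewrite /killing /lftrace big1 // => i _.
by rewrite comp_lfunE !lfunE /= (lie_antisym lie) cZ oppr0 linear0.
Qed.

(** * The image of ad u *)

Theorem proposition6p12 (R : realType) (g0 U : vectType R)
  (br : {bilinear g0 -> g0 -> g0}) (act : {bilinear g0 -> U -> U})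
  (ip : {dot (U * g0)%type for idfun})
  (brn : {bilinear (U * g0)%type -> (U * g0)%type -> (U * g0)%type})
  (h0 : {vspace g0})
  (Lp : set (functional h0))
  (Xm : functional h0 -> complexified g0)
  (lam : functional h0) (Ht : subvs_of h0) (u : U) :
  compact_semisimple br ->
  lie_module br act ->
  adapted_inner_product br act ip ->
  two_step_bracket act ip brn ->
  maximal_abelian br h0 ->
  half_of (lie_weights act) Lp ->
  negative_root_vectors br Xm ->
  Lp lam ->
  ~ (exists2 alpha, lie_roots br alpha & lam *+ 2 = alpha) ->
  ~ (exists alpha beta,
       [/\ lie_roots br alpha, lie_roots br beta & lam *+ 2 = alpha + beta]) ->
  is_dual_vector ip lam Ht ->
  real_weight_space act lam u ->
  let adU := [set brn (inU g0 u) (inU g0 u') | u' in setT] in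
  let line := real_line (vsval Ht) in
  let glam := real_root_space br lam in
  let rest := sumfam (Phi_at br act lam) (real_root_space br (h0 := h0)) in
  let rhs := ing0 U @` sumset (sumset line glam) rest in
  [/\ direct3 line glam rest,
      adU `<=` rhs
    & ~ Sigma' br act Xm lam u -> adU = rhs].
Proof.
move=> compact mod [_ ipU_skew ipg_skew] [[brn_alt _] _ brn_img brn_ip] h0_max.
move=> [LpL _] negX Lplam no_root no_sum dual ulam adU line glam rest rhs.
have [lie _] := compact.
have [lam0 Vlam] := LpL _ Lplam.
have inU_inj : injective (@inU R g0 U) by move=> a b [].
have ing0_inj : injective (@ing0 R g0 U) by move=> a b [].
pose ipU := pullback_dot ip (@inU_linear R g0 U) inU_inj.
pose ipg := pullback_dot ip (@ing0_linear R g0 U) ing0_inj.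
pose bk : {bilinear U -> U -> g0} := derived_bracket brn.
have bkE a b : brn (inU g0 a) (inU g0 b) = ing0 U (bk a b).
  by have [Z _ ZE] := brn_img (inU g0 a) (inU g0 b); rewrite /bk /= /derived_bracket -ZE.
have ip_bk a b Z : ipg (bk a b) Z = ipU (act Z a) b.
  by rewrite -[LHS]/(ip (ing0 U (bk a b)) (ing0 U Z)) -bkE brn_ip.
have bk_alt a : bk a a = 0 by rewrite /bk /= /derived_bracket brn_alt.
have skewg X Y Z : ipg (br X Y) Z = - ipg Y (br X Z) by exact: ipg_skew.
have skewU X a b : ipU (act X a) b = - ipU a (act X b) by exact: ipU_skew.
have Ht_dual H : (ipg (vsval H) (vsval Ht))%:C%C = - 'i%C * lam (toC H).
  exact: dual.
clearbody ipg ipU.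
have lam_not_root : ~ lie_roots br lam.
  by move=> rl; apply: no_sum; exists lam, lam; split.
have glamE : glam = [set 0] by rewrite /glam /real_root_space asboolF.
have [v vlam uE] := real_weight_spaceP skewU ulam.
have rhsE x : sumset line rest x -> rhs (ing0 U x).
  move=> [a la [b rb <-]]; exists (a + b) => //; exists a; last by exists b.
  by exists a => //; exists 0; rewrite ?glamE ?addr0.
have sub : adU `<=` rhs.
  move=> _ [x _ <-]; rewrite bkE; apply: rhsE; rewrite uE.
  exact: (bk_in_sum lie mod h0_max skewg skewU ip_bk vlam Ht_dual).
split=> //.
  (* Directness: the line lies in h0, which is orthogonal to root spaces. *)
  move=> a b d [k _ ka]; rewrite glamE => -> [s [f [fP dE]]]; rewrite addr0.
  move=> ad0; suff a0 : a = 0 by split=> //; rewrite a0 add0r in ad0.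
  apply: (@ip_eq0 _ _ ipg).
  have -> : ipg a a = - ipg d a.
    by apply/eqP; rewrite -addr_eq0 -ipDl ad0 ip0l.
  apply/eqP; rewrite oppr_eq0; apply/eqP; rewrite dE.
  rewrite big_seq; elim/big_ind: _ => [|x y xa ya|alpha /fP[[ralpha _]]].
  - exact: ip0l.
  - by rewrite ipDl xa ya addr0.
  rewrite /real_root_space asboolT // => /(real_weight_spaceP skewg)[X gX ->].
  have [alpha0 _] := ralpha.
  have aE : toC a = of_cartan (toC (k *: Ht)) by rewrite -ka; exact: cplx_inj.
  have a_weight0 : weight_space br (0 : functional h0) (toC a).
    by apply/(zero_weight_spaceP lie h0_max); rewrite aE; eexists.
  have := weight_spaces_orthogonal skewg alpha0 gX a_weight0.
  by case=> /=; rewrite (ipC ipg _ 0) ip0l addr0.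
move=> nSigma; apply/seteqP; split=> // _ [x xrhs <-].
have image0 : exists y, bk u y = 0 by exists 0; rewrite linear0r.
have imageD x1 x2 : (exists y, bk u y = x1) -> (exists y, bk u y = x2) ->
    exists y, bk u y = x1 + x2.
  by move=> [y1 <-] [y2 <-]; exists (y1 + y2); rewrite linearDr.
suff [y <-] : exists y, bk u y = x by exists y => //; rewrite bkE.
(* toC u = v' + J v' holds for v' = v / 2, as u is the real part of v. *)
have kerX alpha : Phi_at br act lam alpha -> cplx_bil act (Xm alpha) v != 0.
  move=> Phia; apply/eqP => Xv0; apply: nSigma; exists (2^-1 *: v).
    rewrite /Sigma asboolF; last by case.
    exists alpha => //; split; first exact: weight_spaceZ.
    by rewrite cplx_bilZr Xv0 scaler0.
  rewrite cplx_conjZ conjc_inv conjc_nat -scalerDr -toC_cre -uE.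
  by rewrite -scalerMnr scalerMnl -mulr_natr mulVf ?scale1r // pnatr_eq0.
have v0 : v != 0.
  have [w wlam w0] : exists2 w, weight_space act lam w & w != 0.
    apply: contrapT => noW; apply: Vlam; apply/seteqP; split=> w /=.
      by move=> wlam; apply: contrapT => /eqP w0; apply: noW; exists w.
    by move=> ->; apply: weight_space0.
  have [alpha /kerX] := Phi_at_nonempty lie mod h0_max skewg skewU bk_alt ip_bk
    wlam Ht_dual (compact_center compact) lam0 w0.
  by apply: contra => /eqP ->; rewrite (linear0r (cplx_bil act)).
have [_ [l [k _ <-] [b bE <-]] [_ [s [f [fP ->]]] <-]] := xrhs.
rewrite glamE in bE; rewrite bE {b bE}.
rewrite addr0; apply: (imageD _ _).
  have [y yE] := bk_onto_dual lie mod h0_max skewg skewU bk_alt ip_bk vlam Ht_dual v0.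
  by exists (k *: y); rewrite linearZr_LR uE yE.
rewrite big_seq; elim/big_ind: _ => [//||alpha /fP[Phia]]; first exact: imageD.
have [[alpha0 _] _] := Phia; have [ralpha _] := Phia.
rewrite /real_root_space asboolT // uE.
have [gX X0] := negX _ ralpha.
apply: (bk_onto_root lie mod h0_max skewg skewU ip_bk vlam alpha0 gX (kerX _ Phia)).
apply: contrapT => g0n; have [n0|n0] := eqVneq (lam *+ 2 - alpha) 0.
  by apply: no_root; exists alpha => //; apply/eqP; rewrite -subr_eq0 n0.
apply: no_sum; exists alpha, (lam *+ 2 - alpha); split=> //.
by rewrite addrCA subrr addr0.
Qed.
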